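(* Let $1<p<\infty$. Assume - either that $p<d$ and $\Gamma$ is the Cayley graph (for a finite generating set) of a group $G$ which is finitely generated and has growth at least polynomial of degree $d$; - or that $p<d/2$ and $\Gamma$ is a graph (infinite and connected) with a $d$-dimensional isoperimetric profile. Then the $p$-Royden boundary and the $p$-harmonic boundary of $\Gamma$ are equal.
   Context: Let $\Gamma$ have vertex set $X$ and edge set $E$, and for $f:X\to\mathbb{C}$ let $\nabla f(x,y)=f(y)-f(x)$ for edges $(x,y)$. Fix $o\in X$. $\mathsf{D}^p(\Gamma)=\{f:X\to\mathbb{C}:\nabla f\in\ell^pE\}$ is normed by $\|f\|_{\mathsf{D}^p}=(\|\nabla f\|_p^p+|f(o)|^p)^{1/p}$. $\mathsf{BD}^p(\Gamma)=\mathsf{D}^p(\Gamma)\cap\ell^\infty(X)$ with norm $\|f\|_\infty+\|\nabla f\|_p$ is a commutative Banach algebra under pointwise operations, closed under conjugation. Let $\mathrm{Sp}$ be its space of non-zero ($*$-)characters with the weak-$*$ topology; $X$ is mapped to $\mathrm{Sp}$ by point evaluations and is identified with its image. The $p$-Royden boundary is $R_p=\mathrm{Sp}\setminus X$. The $p$-harmonic boundary is $\{\chi\in R_p:\chi(f)=0\text{ for all }f\in\mathsf{D}^p_0\cap\ell^\infty(X)\}$, where $\mathsf{D}^p_0$ is the closure of the finitely supported functions in $\mathsf{D}^p(\Gamma)$. $\Gamma$ has a $d$-dimensional isoperimetric profile if there is $c>0$ with $|\partial A|\ge c|A|^{(d-1)/d}$ for all finite $A\subset X$, $\partial A$ being the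 set of edges between $A$ and its complement. Growth at least polynomial of degree $d$ means that balls of radius $n$ have at least $cn^d$ elements for some $c>0$ and all $n\geq 1$.
   Formalization: In the second alternative the graph is also assumed to have uniformly bounded valency; without this the claim fails (p=4, d=10, clique layers of size about k^(9/11) with consecutive layers completely joined give a 4-parabolic graph with a 10-dimensional profile). *)

(* Defs.v *)
From HB Require Import structures.
From mathcomp Require Import all_boot all_order all_algebra.
From mathcomp Require Import finmap all_classical all_reals all_analysis.
From mathcomp Require Import complex.

Set Implicit Arguments.
Unset Strict Implicit.
Unset Printing Implicit Defensive.

Import Order.TTheory GRing.Theory Num.Theory.
Import ComplexField.Normc.

Local Open Scope classical_set_scope.
Local Open Scope ring_scope.

(* The edge set is a symmetric subset of the ordered pairs of vertices: every
   unoriented edge between distinct vertices is counted twice in sums over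
   [edges]. Loops are allowed; they have no influence on what follows. *)
Record graph := Graph {
  vertex :> choiceType;
  adj : rel vertex;
  adj_sym : symmetric adj }.

Section Graphs.
Variable Gamma : graph.

Definition edges : set (Gamma * Gamma) := [set e | adj e.1 e.2].

Definition gball (x : Gamma) (n : nat) : set Gamma :=
  [set y | exists s : seq Gamma,
             [/\ path (@adj Gamma) x s, last x s = y & (size s <= n)%N]].

Definition connected_graph : Prop := forall x y : Gamma, exists n, gball x n y.

Definition infinite_graph : Prop := infinite_set [set: Gamma].

(* The usual standing convention for graphs in this setting. It matters: on
   graphs of unbounded valency an isoperimetric profile does not prevent
   p-parabolicity, even for p < d / 2. *)
Definition bounded_valency : Prop :=
  exists N : nat, forall x : Gamma, ([set y | adj x y] #<= `I_N)%card.

(* Each boundary edge is counted once, oriented from A to its complement. *)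
Definition edge_boundary (A : {fset Gamma}) : set (Gamma * Gamma) :=
  [set e | [/\ edges e, e.1 \in A & e.2 \notin A]].

End Graphs.

Arguments edges Gamma : clear implicits.

(* [fset_set] is the empty set on infinite sets; balls and edge boundaries of
   finite sets are finite as soon as the valency is bounded. *)
Definition isoperimetric_profile (R : realType) (d : R) (Gamma : graph) : Prop :=
  exists2 c : R, 0 < c & forall A : {fset Gamma},
    c * (#|` A|%:R `^ ((d - 1) / d)) <= #|` fset_set (edge_boundary A)|%:R.

Definition growth_at_least (R : realType) (d : R) (Gamma : graph) : Prop :=
  exists2 c : R, 0 < c & forall (x : Gamma) (n : nat), (1 <= n)%N ->
    c * (n%:R `^ d) <= #|` fset_set (gball x n)|%:R.

Section Cayley.
Variables (G : groupType) (S : seq G).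

Definition generates : Prop := forall g : G, exists2 w : seq G,
  all (fun s => (s \in S) || (s^-1%g \in S)) w & g = (\prod_(s <- w) s)%g.

(* S is not required to be symmetric. *)
Definition cayley_adj : rel G :=
  fun x y => has (fun s => (y == x * s)%g || (x == y * s)%g) S.

Lemma cayley_adj_sym : symmetric cayley_adj.
Proof. by move=> x y; apply: eq_has => s; rewrite orbC. Qed.

Definition cayley_graph : graph := Graph cayley_adj_sym.

End Cayley.

Section DirichletSpace.
Variables (R : realType) (p : R) (Gamma : graph).
Implicit Types f g : Gamma -> R[i].

Definition grad f (e : Gamma * Gamma) : R[i] := f e.2 - f e.1.

(* The p-th power of the l^p norm of the gradient. *)
Definition energy f : \bar R :=
  (\esum_(e in edges Gamma) (normc (grad f e) `^ p)%:E)%E.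

Definition Dirichlet : set (Gamma -> R[i]) := [set f | (energy f < +oo)%E].

Definition Dirichlet_norm (o : Gamma) f : \bar R :=
  ((energy f + (normc (f o) `^ p)%:E) `^ p^-1)%E.

Definition finitely_supported f : Prop := finite_set [set x | f x != 0].

(* The closure in [Dirichlet] of the finitely supported functions. *)
Definition Dirichlet0 (o : Gamma) : set (Gamma -> R[i]) :=
  [set f | Dirichlet f /\ forall eps : R, 0 < eps ->
     exists2 g, finitely_supported g & (Dirichlet_norm o (f - g)%R < eps%:E)%E].

Definition bounded_function f : Prop :=
  exists M : R, forall x, normc (f x) <= M.

Definition BDpred : {pred Gamma -> R[i]} :=
  mem [set f | Dirichlet f /\ bounded_function f].

End DirichletSpace.

Arguments BDpred {R} p Gamma.

(* The algebra BD^p; its elements are bundled with membership, and the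
   hypothesis on p makes it an algebra. *)
Record BD (R : realType) (p : R) (p1 : 1 < p) (Gamma : graph) := MkBD {
  BDfun :> Gamma -> R[i];
  BDfunP : BDfun \in BDpred p Gamma }.

Section BDAlgebra.
Variables (R : realType) (p : R) (p1 : 1 < p) (Gamma : graph).
Local Notation BD := (BD p1 Gamma).
Local Notation BDpred := (BDpred p Gamma).
Implicit Types f g : Gamma -> R[i].

HB.instance Definition _ := [isSub for @BDfun R p p1 Gamma].
HB.instance Definition _ := [Choice of BD by <:].

Let p0 : 0 < p. Proof. exact: lt_trans p1. Qed.

Lemma BDpredP f :
  reflect (Dirichlet p f /\ bounded_function f) (f \in BDpred).
Proof. by apply: (iffP idP) => [/set_mem|/mem_set]. Qed.

Let normc_ge0 (z : R[i]) : 0 <= normc z.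
Proof. by case: z => a b; exact: sqrtr_ge0. Qed.

Let powR_add_le (a b : R) : 0 <= a -> 0 <= b ->
  (a + b) `^ p <= 2 `^ p * (a `^ p + b `^ p).
Proof.
move=> a0 b0; wlog ab : a b a0 b0 / a <= b => [H|].
  by have [/H->//|/ltW ba] := leP a b; rewrite addrC [in leRHS]addrC H.
apply: (@le_trans _ _ ((2 * b) `^ p)).
  apply: ge0_ler_powR; rewrite ?nnegrE ?(ltW p0) ?addr_ge0 ?mulr_ge0//.
  by rewrite mulr_natl mulr2n lerD2r.
by rewrite powRM// ler_wpM2l ?powR_ge0// lerDr powR_ge0.
Qed.

(* A gradient dominated edgewise by a combination of two p-summable gradients
   is p-summable. *)
Let Dirichlet_dom f g h (a b : R) : 0 <= a -> 0 <= b ->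
  (forall e, normc (grad h e) <= a * normc (grad f e) + b * normc (grad g e)) ->
  Dirichlet p f -> Dirichlet p g -> Dirichlet p h.
Proof.
move=> a0 b0 dom fD gD.
have E0 k (e : Gamma * Gamma) : (0 <= (normc (grad k e) `^ p)%:E :> \bar R)%E.
  by rewrite lee_fin powR_ge0.
have sZ (c : R) k : 0 <= c -> Dirichlet p k ->
    (\esum_(e in edges Gamma) (c * normc (grad k e) `^ p)%:E < +oo)%E.
  move=> c0 kD; apply: (@le_lt_trans _ _ (c%:E * energy p k)%E); last first.
    by rewrite lte_mul_pinfty.
  apply: ge_ereal_sup => _ [A [Afin AE]] <-.
  rewrite (eq_fsbigr (fun e => c%:E * (normc (grad k e) `^ p)%:E)%E); last first.
    by move=> e _; rewrite EFinM.
  rewrite -ge0_mule_fsumr//; apply: lee_wpmul2l; first by rewrite lee_fin.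
  by apply: ereal_sup_ubound; exists A.
apply: (@le_lt_trans _ _ (\esum_(e in edges Gamma)
    ((2 `^ p * a `^ p * normc (grad f e) `^ p)%:E +
     (2 `^ p * b `^ p * normc (grad g e) `^ p)%:E))%E).
  apply: le_esum => e _; rewrite -EFinD lee_fin -!mulrA -mulrDr -!powRM//.
  apply: le_trans (powR_add_le _ _); rewrite ?mulr_ge0//.
  by apply: ge0_ler_powR; rewrite ?nnegrE ?(ltW p0) ?addr_ge0 ?mulr_ge0.
rewrite esumD; first by rewrite lte_add_pinfty// sZ ?mulr_ge0 ?powR_ge0.
all: by move=> e _; rewrite lee_fin !mulr_ge0 ?powR_ge0.
Qed.

Lemma BD_cst (c : R[i]) : (fun=> c) \in BDpred.
Proof.
apply/BDpredP; split; last by exists (normc c).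
rewrite /Dirichlet /= /energy esum1// => e _.
by rewrite /grad subrr normc0 powR0// gt_eqF.
Qed.

Lemma BD_lin : GRing.linear_closed BDpred.
Proof.
move=> c f g /BDpredP[fD [M fM]] /BDpredP[gD [N gN]]; apply/BDpredP; split.
  apply: (Dirichlet_dom (normc_ge0 c) ler01 _ fD gD) => e.
  rewrite mul1r -normcM; apply: le_trans (le_normcD _ _).
  by rewrite /grad /= mulrBr opprD addrACA.
exists (normc c * M + N) => x; apply: (le_trans (le_normcD _ _)).
by rewrite normcM lerD// ler_wpM2l.
Qed.

Lemma BD_mul : GRing.mulr_2closed BDpred.
Proof.
move=> f g /BDpredP[fD [M fM]] /BDpredP[gD [N gN]]; apply/BDpredP; split.
  have [M0 N0] : 0 <= `|M| /\ 0 <= `|N| by [].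
  apply: (Dirichlet_dom N0 M0 _ fD gD) => e.
  have -> : grad (f * g) e = g e.2 * grad f e + f e.1 * grad g e.
    rewrite /grad /= !mulrBr addrA [g _ * f _]mulrC [g _ * f _]mulrC.
    by rewrite subrK.
  apply: (le_trans (le_normcD _ _)); rewrite !normcM.
  by apply: lerD; apply: ler_wpM2r => //; apply: le_trans (ler_norm _).
exists (M * N) => x; rewrite normcM; exact: ler_pM.
Qed.

Lemma BD_subring : GRing.subring_closed BDpred.
Proof.
split; [exact: BD_cst | | exact: BD_mul].
move=> f g fB gB; have := BD_lin (-1) gB fB.
by rewrite scaleN1r addrC.
Qed.

Lemma BD_submod : GRing.submod_closed BDpred.
Proof. by split; [exact: BD_cst | exact: BD_lin]. Qed.

HB.instance Definition _ := GRing.isSubringClosed.Build _ BDpred BD_subring.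
HB.instance Definition _ := GRing.isSubmodClosed.Build _ _ BDpred BD_submod.
HB.instance Definition _ :=
  GRing.SubChoice_isSubComPzRing.Build _ _ BD BD_subring.
HB.instance Definition _ := [SubZmodule_isSubLmodule of BD by <:].

Lemma BD_conj (f : BD) : (fun x => conjc (f x)) \in BDpred.
Proof.
have nJ (z : R[i]) : normc (conjc z) = normc z.
  by case: z => a b /=; rewrite sqrrN.
have /BDpredP[fD [M fM]] := BDfunP f; apply/BDpredP; split.
  apply: le_lt_trans fD; apply: le_esum => e _; rewrite lee_fin.
  by rewrite /grad -rmorphB nJ.
by exists M => x; rewrite nJ.
Qed.

Definition BDconj (f : BD) : BD := MkBD p1 (BD_conj f).

End BDAlgebra.

Section Boundaries.
Variables (R : realType) (p : R) (p1 : 1 < p) (Gamma : graph).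
Local Notation BD := (BD p1 Gamma).

(* Continuity is not demanded: characters of a Banach algebra are continuous.
   The topology of pointwise convergence on functionals restricts to the
   weak-* topology on the spectrum. *)
Definition spectrum : set {ptws BD -> R[i]^o} :=
  [set chi | [/\ exists f : BD, chi f != 0,
                 linear (chi : BD -> R[i]),
                 {morph (chi : BD -> R[i]) : f g / f * g} &
                 forall f : BD, chi (BDconj f) = conjc (chi f)]].

Definition evaluation (x : Gamma) : {ptws BD -> R[i]^o} := fun f => f x.

Definition Royden_boundary : set {ptws BD -> R[i]^o} :=
  spectrum `\` range evaluation.

Definition harmonic_boundary (o : Gamma) : set {ptws BD -> R[i]^o} :=
  [set chi | Royden_boundary chi /\
     forall f : BD, Dirichlet0 p o f -> chi f = 0].

End Boundaries.

Arguments spectrum {R p} p1 Gamma.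
Arguments Royden_boundary {R p} p1 Gamma.
Arguments harmonic_boundary {R p} p1 {Gamma} o.

(* Main.v *)
Require Import Defs.
From HB Require Import structures.
From mathcomp Require Import all_boot all_order all_algebra.
From mathcomp Require Import finmap all_classical all_reals all_analysis.
From mathcomp Require Import complex lra.

Set Implicit Arguments.
Unset Strict Implicit.
Unset Printing Implicit Defensive.

Import Order.TTheory GRing.Theory Num.Theory.
Import ComplexField.Normc.

Local Open Scope classical_set_scope.
Local Open Scope ring_scope.

(* Both alternatives give a d-dimensional isoperimetric inequality with p <
   d; on groups it follows from the growth by averaging the number of points
   that right translations move out of a finite set (Coulhon and Saloff-
   Coste).

   Let g be finitely supported and order its support so that |g| decreases.
   The isoperimetric inequality for the initial segments of this order
   bounds sup |g| by a constant times the sum of i^(-(d-1)/d) |grad g(e)|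
   over the edges e, i being the position of the endpoint of e where |g| is
   larger. By Young's inequality sup |g| <= delta + C_delta |grad g|_p^p,
   since p < d makes i^(-(d-1)/d) p'-summable for the exponent p' conjugate
   to p. Hence the elements of D^p_0 vanish at infinity. A character that
   does not vanish on such a function is non-zero on the indicator function
   of some vertex, so it is the evaluation at that vertex. *)

(** * Real inequalities: the modulus, a convergent series, a weighted Young inequality *)

Lemma normc_ge0 (R : rcfType) (z : R[i]) : 0 <= normc z.
Proof. by case: z => a b; exact: sqrtr_ge0. Qed.

Lemma ler_normcB (R : rcfType) (z w : R[i]) : normc z - normc w <= normc (z - w).
Proof. by rewrite lerBlDr -{1}[z](subrK w) le_normcD. Qed.

Lemma normc_distrC (R : rcfType) (z w : R[i]) : normc (z - w) = normc (w - z).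
Proof. by rewrite -normcN opprB. Qed.

(** Comparison with a telescoping series. With t = a - 1, the bounds ln(1 + y) <= y and exp(z) >= 1
    + z give (1 - 1/x)^(-t) >= 1 + t/x, that is, t x^(-a) <= (x - 1)^(-t) - x^(-t). *)
Lemma powR_series_bounded (R : realType) (a : R) : 1 < a ->
  exists2 K : R, 0 <= K & forall n, \sum_(0 <= i < n) i.+1%:R `^ (- a) <= K.
Proof.
move=> a1; set t := a - 1; have t0 : 0 < t by rewrite subr_gt0.
have step n : t * n.+2%:R `^ (- a) <= n.+1%:R `^ (- t) - n.+2%:R `^ (- t).
  set x : R := n.+2%:R; set y : R := n.+1%:R.
  have x0 : 0 < x by []. have y0 : 0 < y by [].
  have xyE : y / x = 1 + (- x^-1).
    have -> : y = x - 1 by rewrite /x -natr1 addrK.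
    by rewrite mulrBl divff ?gt_eqF// mul1r.
  have -> : y `^ (- t) = x `^ (- t) * (y / x) `^ (- t).
    by rewrite -powRM ?divr_ge0 ?ltW// mulrCA divff ?gt_eqF// mulr1.
  have lnb : ln (y / x) <= - x^-1.
    rewrite xyE; apply: le_ln1Dx; rewrite ltrN2 invf_lt1//.
    by rewrite /x ltr1n.
  have : 1 + t / x <= (y / x) `^ (- t).
    rewrite /powR gt_eqF ?divr_gt0//; apply: le_trans (expR_ge1Dx _).
    by rewrite lerD2l mulNr -mulrN ler_wpM2l ?(ltW t0)// lerNr.
  have -> : x `^ (- a) = x `^ (- t) / x.
    rewrite -[X in _ / X]powRr1 ?(ltW x0)// -powRB; last first.
      by apply/implyP => _; rewrite gt_eqF.
    by congr (_ `^ _); rewrite /t; lra.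
  have := powR_gt0 (- t) x0; set X := x `^ _; set Y := _ `^ (- t).
  move=> X0 H; have := ler_wpM2l (ltW X0) H.
  by rewrite mulrDr mulr1 mulrCA lerBrDl.
exists (1 + t^-1); first by rewrite addr_ge0// invr_ge0 ltW.
have H n : \sum_(0 <= i < n.+1) (i.+1%:R : R) `^ (- a) <=
    1 + (1 - n.+1%:R `^ (- t)) / t.
  elim: n => [|n IH].
    by rewrite big_nat1 !powR1 subrr mul0r addr0.
  rewrite big_nat_recr//=; apply: le_trans (lerD IH (lexx _)) _.
  rewrite -addrA lerD2l -lerBrDl -mulrBl ler_pdivlMr// mulrC.
  by apply: le_trans (step n) _; lra.
case=> [|n]; first by rewrite big_geq// addr_ge0// invr_ge0 ltW.
apply: le_trans (H n) _.
rewrite lerD2l ler_pdivrMr// mulVf ?gt_eqF// gerBl powR_ge0.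
Qed.

(** Young's inequality for the product of tau w and m / tau with tau = eta^(1/q); the factors 1/q
    and 1/p are at most 1 and are dropped. *)
Lemma young_scaled (R : realType) (p q eta w m : R) :
  1 < p -> 1 < q -> p^-1 + q^-1 = 1 -> 0 < eta -> 0 <= w -> 0 <= m ->
  w * m <= eta * w `^ q + eta `^ (- (p / q)) * m `^ p.
Proof.
move=> p1 q1 pq e0 w0 m0.
have p0 := lt_trans ltr01 p1; have q0 := lt_trans ltr01 q1.
set tau := eta `^ q^-1; have t0 : 0 < tau by rewrite powR_gt0.
have -> : w * m = (tau * w) * (tau^-1 * m).
  by rewrite mulrACA divff ?gt_eqF// mul1r.
have tw0 : 0 <= tau * w by rewrite mulr_ge0// ltW.
have tm0 : 0 <= tau^-1 * m by rewrite mulr_ge0// invr_ge0 ltW.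
have qp : q^-1 + p^-1 = 1 by rewrite addrC.
apply: (le_trans (conjugate_powR tw0 tm0 q0 p0 qp)).
rewrite !powRM ?invr_ge0 ?(ltW t0)//; apply: lerD.
  rewrite /tau -powRrM mulVf ?gt_eqF// powRr1 ?(ltW e0)//.
  by rewrite ler_pdivrMr// ler_peMr ?(ltW q1)// mulr_ge0 ?powR_ge0 ?ltW.
have -> : tau^-1 `^ p = eta `^ (- (p / q)).
  by rewrite /tau -powRN -powRrM -mulNr mulrC mulrN mulNr.
by rewrite ler_pdivrMr// ler_peMr ?(ltW p1)// mulr_ge0 ?powR_ge0.
Qed.

(** * Energy and finite sums over lists of edges *)

Section Energy.
Variables (R : realType) (p : R) (Gamma : graph).
Implicit Types (f g : Gamma -> R[i]) (M : R).

Lemma sum_le_energy f (F : seq (Gamma * Gamma)) :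
  uniq F -> {in F, forall e, adj e.1 e.2} ->
  ((\sum_(e <- F) normc (grad f e) `^ p)%:E <= energy p f)%E.
Proof.
move=> uF FE; apply: esum_ge; exists [set` F].
  by split; [exact: finite_seq | move=> e /= /FE].
by rewrite -fsbig_seq// sumEFin.
Qed.

Lemma energy_le f M :
  (forall F : seq (Gamma * Gamma), uniq F -> {in F, forall e, adj e.1 e.2} ->
     \sum_(e <- F) normc (grad f e) `^ p <= M) ->
  (energy p f <= M%:E)%E.
Proof.
move=> H; apply: ge_ereal_sup => _ [A [Afin AE]] <-.
rewrite fsbig_finite// sumEFin lee_fin; apply: H; first exact: fset_uniq.
by move=> e; rewrite in_fset_set// => /set_mem /AE.
Qed.

Lemma sum_le_bound f M (F : seq (Gamma * Gamma)) : (energy p f <= M%:E)%E ->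
  uniq F -> {in F, forall e, adj e.1 e.2} ->
  \sum_(e <- F) normc (grad f e) `^ p <= M.
Proof. by move=> fM uF FE; rewrite -lee_fin (le_trans (sum_le_energy _ uF FE)). Qed.

End Energy.

(** * Isoperimetry applied to superlevel sets *)

Section LevelSets.
Variables (R : realType) (Gamma : graph) (c s : R).
Hypotheses (c0 : 0 <= c)
  (iso : forall A : {fset Gamma},
    c * #|` A|%:R `^ s <= #|` fset_set (edge_boundary A)|%:R).
Variables (l : seq Gamma) (u : Gamma -> R) (F : seq (Gamma * Gamma)).
Hypotheses (ul : uniq l) (sl : sorted (fun x y => u y <= u x) l)
  (u0 : forall x, 0 <= u x) (ul0 : forall x, x \notin l -> u x = 0)
  (s0 : 0 <= s) (lF : forall e, adj e.1 e.2 -> e.1 \in l -> e \in F).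

Let h i := nth 0 (map u l) i.

(** A vertex outside [l] has index [size l], where [nth] returns its default 0, which is also the
    value of [u] there. *)
Let hE x : u x = h (index x l).
Proof.
rewrite /h; have [xl|xl] := boolP (x \in l).
  by rewrite (nth_map x) ?index_mem// nth_index.
by rewrite nth_default ?ul0// size_map memNindex.
Qed.

Let h_ge0 i : 0 <= h i.
Proof.
rewrite /h; have [il|il] := ltnP i (size (map u l)).
  by have /mapP[x _ ->] := mem_nth 0 il.
by rewrite nth_default.
Qed.

Let h_dec i j : (i <= j)%N -> h j <= h i.
Proof.
move=> ij; have [jl|jl] := ltnP j (size (map u l)); last first.
  by rewrite {1}/h nth_default.
have sh : sorted (fun a b : R => b <= a) (map u l) by rewrite sorted_map.
apply: (sorted_leq_nth _ _ 0 sh) => //; rewrite ?inE//.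
- by move=> a b e ba eb; apply: le_trans ba.
- exact: leq_ltn_trans jl.
Qed.

(** This is the isoperimetric inequality for the set of the first k + 1 entries of [l]. Its boundary
    edges go from an index at most k to an index above k; a vertex off the list has index [size l]
    and so counts as above. *)
Let level_count k : (k < size l)%N ->
  c <= k.+1%:R `^ (- s) *
       \sum_(e <- F | (index e.1 l <= k < index e.2 l)%N) 1.
Proof.
move=> kl; set A := [fset x in take k.+1 l]%fset.
have inA x : (x \in A) = (index x l <= k)%N.
  by rewrite !inE/= in_take_leq.
have cA : #|` A| = k.+1.
  by rewrite card_fseq undup_id ?take_uniq// size_takel.
have k0 : 0 < k.+1%:R `^ s :> R by rewrite powR_gt0.
rewrite powRN mulrC ler_pdivlMr//.
have := iso A; rewrite cA => /le_trans; apply.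
rewrite big_const_seq iter_addr addr0 ler_nat -size_filter.
have [fb|nfb] := pselect (finite_set (edge_boundary A)); last first.
  have -> : fset_set (edge_boundary A) = fset0.
    by rewrite /fset_set; case: pselect.
  by rewrite cardfs0.
apply: uniq_leq_size; first exact: fset_uniq.
move=> e; rewrite in_fset_set// => /set_mem[ee e1 e2].
move: e1 e2; rewrite mem_filter !inA -ltnNge => e1 ->; rewrite e1/=.
by apply: lF => //; rewrite -index_mem (leq_ltn_trans e1).
Qed.

(* Writing u x as a telescoping sum over the levels, each step being weighted
   by the isoperimetric inequality for the superlevel set, and exchanging the
   sum over levels with the sum over edges. *)
Lemma level_set_bound x :
  c * u x <= \sum_(e <- F | (index e.1 l < index e.2 l)%N)
    (index e.1 l).+1%:R `^ (- s) * (u e.1 - u e.2).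
Proof.
apply: (@le_trans _ _ (c * h 0)); first by rewrite hE ler_wpM2l// h_dec.
have -> : h 0 = \sum_(0 <= k < size l) (h k - h k.+1).
  rewrite (telescope_sumr_eq (fun k => - h k))// => [|k _].
    by rewrite opprK [h (size l)]nth_default ?size_map// oppr0 add0r.
  by rewrite opprK addrC.
rewrite mulr_sumr.
apply: (@le_trans _ _ (\sum_(0 <= k < size l)
   \sum_(e <- F | (index e.1 l <= k < index e.2 l)%N)
     (h k - h k.+1) * k.+1%:R `^ (- s))).
  rewrite big_nat_cond [leRHS]big_nat_cond.
  apply: ler_sum => k /andP[/andP[_ kl] _].
  have -> : \sum_(e <- F | (index e.1 l <= k < index e.2 l)%N)
      (h k - h k.+1) * k.+1%:R `^ (- s) =
     (h k - h k.+1) * (k.+1%:R `^ (- s) *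
       \sum_(e <- F | (index e.1 l <= k < index e.2 l)%N) 1).
    by rewrite !mulr_sumr; apply: eq_bigr => e _; rewrite mulr1.
  by rewrite mulrC ler_wpM2l ?level_count// subr_ge0 h_dec.
rewrite (exchange_big_dep (fun e => index e.1 l < index e.2 l)%N)/=; last first.
  by move=> k e _ /andP[]; exact: leq_ltn_trans.
apply: ler_sum => e e12; set i := index e.1 l; set j := index e.2 l.
have jl : (j <= size l)%N by rewrite index_size.
(* The edge contributes to the levels k with i <= k < j. Replacing each weight by the largest one,
   at k = i, leaves a sum that telescopes to h i - h j. *)
apply: (@le_trans _ _ (\sum_(i <= k < j) (h k - h k.+1) * i.+1%:R `^ (- s))).
  rewrite (big_nat_widen _ _ _ _ _ jl) [leRHS](big_nat_widenl _ 0)//.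
  under [leRHS]eq_bigl => k do rewrite /= andbC.
  apply: ler_sum => k /andP[ik kj]; apply: ler_wpM2l.
    by rewrite subr_ge0 h_dec.
  rewrite !powRN lef_pV2 ?posrE ?powR_gt0//.
  by apply: ge0_ler_powR; rewrite ?nnegrE// ler_nat.
rewrite -mulr_suml (telescope_sumr_eq (fun k => - h k)); last 2 first.
- exact: ltnW.
- by move=> k _; rewrite opprK addrC.
by rewrite opprK -!hE mulrC addrC.
Qed.

End LevelSets.

(** * Finiteness from bounded valency *)

Section Stars.
Variable Gamma : graph.
Hypothesis bv : bounded_valency Gamma.

Lemma finite_neighbours (x : Gamma) : finite_set [set y | adj x y].
Proof. by apply/finite_set_leP; have [N bN] := bv; exists N. Qed.

Definition star (l : seq Gamma) : seq (Gamma * Gamma) :=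
  [seq (x, y) | x <- l, y <- fset_set [set y | adj x y]].

Lemma mem_star l e : (e \in star l) = (e.1 \in l) && adj e.1 e.2.
Proof.
apply/allpairsPdep/andP => [[x [y [xl + ->]]]|[el ee]] /=.
  rewrite in_fset_set; last exact: finite_neighbours.
  by move=> /set_mem.
exists e.1, e.2; rewrite -surjective_pairing; split => //.
by rewrite in_fset_set ?inE//; exact: finite_neighbours.
Qed.

Lemma star_uniq l : uniq l -> uniq (star l).
Proof.
move=> ul; apply: allpairs_uniq_dep => //.
by move=> [x y] [x' y'] _ _ /= [-> ->].
Qed.

Lemma finite_edge_boundary (A : {fset Gamma}) : finite_set (edge_boundary A).
Proof.
apply: (@sub_finite_set _ _ [set` star A]); last exact: finite_seq.
by move=> e [ee e1 _]; rewrite /= mem_star e1.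
Qed.

End Stars.

(** * Pointwise and norm estimates for functions of finite energy *)

Section FiniteEnergy.
Variables (R : realType) (p : R) (p1 : 1 < p) (Gamma : graph).
Implicit Types (f g : Gamma -> R[i]) (M : R).

Let p0 : 0 < p. Proof. exact: lt_trans p1. Qed.

Lemma powRD_le (a b : R) : 0 <= a -> 0 <= b ->
  (a + b) `^ p <= 2 `^ p * (a `^ p + b `^ p).
Proof.
move=> a0 b0; wlog ab : a b a0 b0 / a <= b => [H|].
  by have [/H->//|/ltW ba] := leP a b; rewrite addrC [in leRHS]addrC H.
apply: (@le_trans _ _ ((2 * b) `^ p)).
  apply: ge0_ler_powR; rewrite ?nnegrE ?(ltW p0) ?addr_ge0 ?mulr_ge0//.
  by rewrite mulr_natl mulr2n lerD2r.
by rewrite powRM// ler_wpM2l ?powR_ge0// lerDr powR_ge0.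
Qed.

Lemma gradB f g e : grad (f - g) e = grad f e - grad g e.
Proof.
rewrite /grad !fctE !opprB -!addrA; congr (_ + _).
by rewrite addrC [RHS]addrCA addrA.
Qed.

Lemma energyB_le f g M M' : (energy p f <= M%:E)%E -> (energy p g <= M'%:E)%E ->
  (energy p (f - g)%R <= (2 `^ p * (M + M'))%:E)%E.
Proof.
move=> fM gM; apply: energy_le => F uF FE.
apply: (@le_trans _ _ (\sum_(e <- F)
   2 `^ p * (normc (grad f e) `^ p + normc (grad g e) `^ p))).
  apply: ler_sum => e _; apply: le_trans (powRD_le _ _); rewrite ?normc_ge0//.
  apply: ge0_ler_powR; rewrite ?nnegrE ?addr_ge0 ?normc_ge0 ?(ltW p0)//.
  by rewrite gradB -[normc (grad g e)]normcN le_normcD.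
rewrite -mulr_sumr ler_wpM2l ?powR_ge0// big_split lerD//;
  exact: sum_le_bound.
Qed.

Lemma grad_le f M e : (energy p f <= M%:E)%E -> adj e.1 e.2 ->
  normc (grad f e) <= M `^ p^-1.
Proof.
move=> fM ee.
have : \sum_(e' <- [:: e]) normc (grad f e') `^ p <= M.
  by apply: sum_le_bound => // e'; rewrite inE => /eqP->.
rewrite big_seq1 => H; have := normc_ge0 (grad f e) => n0.
rewrite -[leLHS](powRr1 n0) -(mulfV (lt0r_neq0 p0)) powRrM.
apply: ge0_ler_powR; rewrite ?nnegrE ?powR_ge0 ?invr_ge0 ?(ltW p0)//.
exact: le_trans (powR_ge0 _ _) H.
Qed.

(** Each edge of the path changes the modulus by at most M^(1/p). This turns smallness in the
    Dirichlet norm into smallness at any given vertex, at a cost depending on its distance from the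
    base point. *)
Lemma path_energy_bound f M x s : (energy p f <= M%:E)%E ->
  path (@adj Gamma) x s ->
  normc (f (last x s)) <= normc (f x) + (size s)%:R * M `^ p^-1.
Proof.
move=> fM; elim: s x => [|y s IH] x /=; first by rewrite mul0r addr0.
move=> /andP[xy /IH] /le_trans; apply.
rewrite -natr1 mulrDl mul1r [leLHS]addrC [leRHS]addrCA lerD2l -lerBlDl.
apply: le_trans (grad_le (e := (x, y)) fM xy).
exact: ler_normcB.
Qed.

Lemma Dirichlet_norm_lt o f (eps : R) : 0 <= eps ->
  (Dirichlet_norm p o f < eps%:E)%E ->
  (energy p f <= (eps `^ p)%:E)%E /\ normc (f o) <= eps.
Proof.
move=> e0 fe; have E0 : (0 <= energy p f)%E.
  by apply: esum_ge0 => e _; rewrite lee_fin powR_ge0.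
have n0 : (0 <= (normc (f o) `^ p)%:E)%E by rewrite lee_fin powR_ge0.
have H : (energy p f + (normc (f o) `^ p)%:E <= (eps `^ p)%:E)%E.
  rewrite leNgt; apply/negP => /ltW lt; move: fe; rewrite ltNge => /negP; apply.
  have := @gt0_ler_poweR R p^-1 _ _ _ _ _ lt.
  rewrite poweR_EFin -powRrM mulfV ?gt_eqF// powRr1//; apply.
  - by rewrite invr_ge0 ltW.
  - by rewrite in_itv/= lee_fin powR_ge0 leey.
  - by rewrite in_itv/= leey andbT adde_ge0.
split; first by apply: le_trans H; rewrite leeDl.
have : ((normc (f o) `^ p)%:E <= (eps `^ p)%:E)%E.
  by apply: le_trans H; rewrite leeDr.
rewrite lee_fin => /(ge0_ler_powR (r := p^-1)).
rewrite !nnegrE !powR_ge0 invr_ge0 (ltW p0) => /(_ isT isT isT).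
by rewrite -!powRrM mulfV ?gt_eqF// !powRr1// normc_ge0.
Qed.

Hypothesis bv : bounded_valency Gamma.

Lemma finitely_supported_BD f : finitely_supported f -> f \in BDpred p Gamma.
Proof.
move=> fin; set l : seq Gamma := fset_set [set x | f x != 0].
have fl x : x \notin l -> f x = 0.
  rewrite /l in_fset_set// => H; apply/eqP; apply: contraNT H => fx.
  exact/mem_set.
apply/BDpredP; split; last first.
  exists (\sum_(x <- l) normc (f x)) => x; have [xl|/fl->] := boolP (x \in l).
    by rewrite (big_rem x)//= lerDl sumr_ge0// => *; exact: normc_ge0.
  by rewrite normc0 sumr_ge0// => *; exact: normc_ge0.
(* [T] holds every oriented edge that meets the support, so the gradient vanishes on edges outside
   it. *)
set T := undup (star l ++ [seq (e.2, e.1) | e <- star l]).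
apply: (@le_lt_trans _ _ (\sum_(e <- T) normc (grad f e) `^ p)%:E); last first.
  exact: ltry.
apply: energy_le => F uF FE.
rewrite (bigID (mem T))/= [X in _ + X]big1_seq ?addr0; last first.
  move=> e /andP[eT /FE ee]; suff -> : grad f e = 0.
    by rewrite normc0 powR0 ?gt_eqF.
  rewrite /grad !fl ?subr0//; apply: contra eT => el; rewrite mem_undup mem_cat.
    by rewrite mem_star// el ee.
  apply/orP; right; apply/mapP; exists (e.2, e.1); last by case: e {FE ee el}.
  by rewrite mem_star//= el adj_sym.
have FT : perm_eq [seq e <- F | e \in T] [seq e <- T | e \in F].
  apply: uniq_perm; rewrite ?filter_uniq ?undup_uniq// => e.
  by rewrite !mem_filter andbC.
rewrite -big_filter (perm_big _ FT) big_filter big_mkcond.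
apply: ler_sum => e _.
by case: ifP => // _; exact: powR_ge0.
Qed.

End FiniteEnergy.

(** * Elements of D^p_0 vanish at infinity *)

Section SupBound.
Variables (R : realType) (p d : R) (p1 : 1 < p) (pd : p < d) (Gamma : graph).
Hypotheses (bv : bounded_valency Gamma) (iso : isoperimetric_profile d Gamma).

(** [C] is fixed before [g]: this uniformity over finitely supported functions is what survives
    approximation in D^p_0. *)
Lemma isoperimetric_sup_bound (delta : R) : 0 < delta ->
  exists2 C : R, 0 <= C & forall (g : Gamma -> R[i]) M x,
    finitely_supported g -> (energy p g <= M%:E)%E ->
    normc (g x) <= delta + C * M.
Proof.
move=> delta0; have [c c0 isoc] := iso; have [N bN] := bv.
have p0 : 0 < p by exact: lt_trans p1.
have d0 : 0 < d by exact: lt_trans pd.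
set s := (d - 1) / d; set q := p / (p - 1).
have pB0 : 0 < p - 1 by rewrite subr_gt0.
have s0 : 0 <= s by rewrite divr_ge0 ?(ltW d0)// subr_ge0 ltW// (lt_trans p1).
have q1 : 1 < q by rewrite ltr_pdivlMr// mul1r gtrBl.
have pq : p^-1 + q^-1 = 1.
  by rewrite /q invf_div mulrBl mul1r divff ?gt_eqF// addrC subrK.
(* Cross-multiplied, this reads d (p - 1) < (d - 1) p, which is p < d. *)
have sq1 : 1 < s * q.
  rewrite /s /q mulf_div ltr_pdivlMr ?mulr_gt0// mul1r.
  by rewrite mulrBr mulrBl mulr1 mul1r ltrD2l ltrN2.
have [K K0 bK] := powR_series_bounded sq1.
(* Chosen so that eta N K <= c delta; the added 1 keeps the denominator positive. *)
set eta := c * delta / (N%:R * K + 1).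
have NK0 : 0 < N%:R * K + 1 by rewrite ltr_wpDl ?mulr_ge0.
have eta0 : 0 < eta by rewrite divr_gt0 ?mulr_gt0.
exists (eta `^ (- (p / q)) / c) => [|g M x fg gM].
  by rewrite divr_ge0 ?powR_ge0 ?ltW.
set u : Gamma -> R := fun y => normc (g y).
set le_u := fun x y : Gamma => u y <= u x.
set l := sort le_u (fset_set [set x | g x != 0]).
have ul : uniq l by rewrite sort_uniq fset_uniq.
have sl : sorted le_u l by apply: sort_sorted => a b; exact: le_total.
have u0 y : 0 <= u y by exact: normc_ge0.
have ul0 y : y \notin l -> u y = 0.
  rewrite mem_sort in_fset_set// => H; suff /eqP e : g y == 0.
    by rewrite /u /= e normc0.
  by apply: contraNT H => gy; apply/mem_set.
have lF e : adj e.1 e.2 -> e.1 \in l -> e \in star l.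
  by move=> ee el; rewrite mem_star// el.
have uF : uniq (star l) by apply: star_uniq.
have FE : {in star l, forall e, adj e.1 e.2}.
  by move=> e; rewrite mem_star// => /andP[].
have := level_set_bound (ltW c0) isoc ul sl u0 ul0 s0 lF x.
set w := fun e : Gamma * Gamma => (index e.1 l).+1%:R `^ (- s).
have w0 e : 0 <= w e by exact: powR_ge0.
(* At most N edges leave each vertex, and the vertices of [l] occupy distinct positions, so the
   series with exponent s q bounds the sum. *)
have weights : \sum_(e <- star l) w e `^ q <= N%:R * K.
  rewrite big_allpairs_dep/=.
  apply: (@le_trans _ _ (\sum_(y <- l) N%:R * (index y l).+1%:R `^ (- (s * q)))).
    apply: ler_sum => y _; rewrite /w /= -powRrM mulNr.
    rewrite big_const_seq count_predT iter_addr addr0 -[leLHS]mulr_natl.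
    by rewrite ler_wpM2r ?powR_ge0// ler_nat geq_card_fset_set.
  rewrite -mulr_sumr ler_wpM2l// (big_nth x) big_nat.
  apply: le_trans (bK (size l)); rewrite big_nat le_eqVlt; apply/orP; left.
  by apply/eqP; apply: eq_bigr => i /andP[_ il]; rewrite index_uniq.
have young e : w e * (u e.1 - u e.2) <=
    eta * w e `^ q + eta `^ (- (p / q)) * normc (grad g e) `^ p.
  apply: le_trans (young_scaled p1 q1 pq eta0 (w0 e) (normc_ge0 _)).
  by rewrite ler_wpM2l// /grad normc_distrC; exact: ler_normcB.
have edge_sum : \sum_(e <- star l | (index e.1 l < index e.2 l)%N)
    w e * (u e.1 - u e.2) <= eta * (N%:R * K) + eta `^ (- (p / q)) * M.
  apply: (@le_trans _ _ (\sum_(e <- star l)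
      (eta * w e `^ q + eta `^ (- (p / q)) * normc (grad g e) `^ p))).
    rewrite big_mkcond; apply: ler_sum => e _; case: ifP => _//.
    by rewrite addr_ge0// mulr_ge0 ?powR_ge0 ?(ltW eta0).
  rewrite big_split -!mulr_sumr lerD// ler_wpM2l ?powR_ge0 ?(ltW eta0)//.
  exact: sum_le_bound.
move=> /le_trans/(_ edge_sum) H.
have : c * u x <= c * delta + eta `^ (- (p / q)) * M.
  apply: le_trans H _; rewrite lerD2r /eta -mulrA ler_piMr//.
    by rewrite mulr_ge0// ltW.
  by rewrite mulrC ler_pdivrMr// mul1r lerDl.
rewrite -ler_pdivlMl// mulrDr mulKf ?gt_eqF//.
by rewrite mulrA [c^-1 * _]mulrC.
Qed.

(** Fix a finitely supported [g] with f - g of small energy; then |f| < eps off its support. As f -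
    g may have infinite support, the sup bound is applied to g' - g instead, where [g'] is a second
    approximation, depending on x, that is close to f at x. *)
Lemma Dirichlet0_vanishes o (f : Gamma -> R[i]) (eps : R) :
  connected_graph Gamma -> Dirichlet0 p o f -> 0 < eps ->
  finite_set [set x | eps <= normc (f x)].
Proof.
move=> conn [_ df] eps0; have p0 : 0 < p by exact: lt_trans p1.
have e80 : 0 < eps / 8 by rewrite divr_gt0.
have [C C0 sup] := isoperimetric_sup_bound e80.
(* If f - g and f - g' have energy at most kappa, the sup bound for g' - g is eps/8 + D kappa, and
   kappa is chosen to make D kappa <= eps/8. With |f - g'| <= eps/4 at x, the total is at most
   eps/2. *)
set D := C * (2 `^ p * 2).
have D0 : 0 <= D by rewrite !mulr_ge0 ?powR_ge0.
set kappa := eps / 8 / (D + 1); have D10 : 0 < D + 1 by rewrite ltr_wpDl.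
have kappa0 : 0 < kappa by rewrite divr_gt0.
set eta := kappa `^ p^-1.
have eta0 : 0 < eta by rewrite powR_gt0.
have etap : eta `^ p = kappa.
  by rewrite /eta -powRrM mulVf ?gt_eqF// powRr1 ?ltW.
have [g fg /(Dirichlet_norm_lt p1 (ltW eta0))[]] := df _ eta0.
rewrite etap => Eg _; apply: (sub_finite_set _ fg) => x /= epsf.
apply/eqP => gx; move: epsf; apply/negP; rewrite -ltNge.
have [n [s [os lx sn]]] := conn o x.
(* The path from o to x costs [size s] gradient steps and the value at o one more, each at most
   [eta']. *)
set eta' := Num.min eta (eps / 4 / (size s).+1%:R).
have eta'0 : 0 < eta' by rewrite lt_min eta0 !divr_gt0.
have [g' fg' /(Dirichlet_norm_lt p1 (ltW eta'0))[Eg' g'o]] := df _ eta'0.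
have fg'x : normc ((f - g') x) <= eps / 4.
  have := path_energy_bound p1 Eg' os; rewrite lx -powRrM mulfV ?gt_eqF//.
  rewrite powRr1 ?(ltW eta'0)// => /le_trans; apply.
  apply: (@le_trans _ _ ((size s).+1%:R * eta')).
    by rewrite -natr1 mulrDl mul1r addrC lerD2l.
  by rewrite mulrC -ler_pdivlMr// ge_min lexx orbT.
have Eg'k : (energy p (f - g')%R <= kappa%:E)%E.
  apply: le_trans Eg' _; rewrite lee_fin -etap.
  by apply: ge0_ler_powR;
    rewrite ?nnegrE ?(ltW p0) ?(ltW eta0) ?(ltW eta'0)// ge_min lexx.
have gg'E : (energy p (g' - g)%R <= (2 `^ p * (kappa + kappa))%:E)%E.
  have := energyB_le p1 Eg Eg'k; congr (energy p _ <= _)%E.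
  by rewrite opprB addrC addrA subrK.
have fgg' : finitely_supported (g' - g).
  apply: (@sub_finite_set _ _ ([set x | g' x != 0] `|` [set x | g x != 0])).
    move=> y /= gy; have [g'0|] := eqVneq (g' y) 0; last by left.
    right; apply/eqP => g0; move: gy.
    have -> : (g' - g) y = g' y - g y by [].
    by rewrite g'0 g0 subrr eqxx.
  by rewrite finite_setU; split.
have := sup _ _ x fgg' gg'E.
have -> : (g' - g) x = g' x - g x by [].
rewrite gx subr0 => g'x.
have CK : C * (2 `^ p * (kappa + kappa)) <= eps / 8.
  have -> : C * (2 `^ p * (kappa + kappa)) = D * kappa.
    by rewrite /D -[kappa + kappa]mulr2n -[kappa *+ 2]mulr_natl !mulrA.
  by rewrite /kappa mulrCA ler_piMr ?(ltW e80)// ler_pdivrMr// mul1r lerDl.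
have : normc (f x) <= normc ((f - g') x) + normc (g' x).
  by rewrite -lerBlDr; exact: ler_normcB.
by lra.
Qed.

End SupBound.

(** * Characters on the Royden boundary *)

Section Characters.
Variables (R : realType) (p : R) (p1 : 1 < p) (Gamma : graph).
Local Notation BD := (BD p1 Gamma).

Let p0 : 0 < p. Proof. exact: lt_trans p1. Qed.

(** The gradient of 1/k on an edge (x, y) is -grad k / (k(x) k(y)), hence at most m^(-2) times that
    of k in modulus. *)
Lemma BD_inv (k : BD) (m : R) : 0 < m -> (forall x, m <= normc (k x)) ->
  (fun x => (k x)^-1) \in BDpred p Gamma.
Proof.
move=> m0 mk; have k0 x : k x != 0.
  by apply: contraTneq (mk x) => ->; rewrite normc0 -ltNge.
have kV x : normc (k x)^-1 <= m^-1.
  by rewrite normcV lef_pV2 ?posrE// (lt_le_trans m0).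
have /BDpredP[kD _] := BDfunP k.
apply/BDpredP; split; last by exists m^-1.
have E0 : (0 <= energy p k)%E.
  by apply: esum_ge0 => e _; rewrite lee_fin powR_ge0.
set M := fine (energy p k).
have kM : (energy p k <= M%:E)%E by rewrite fineK// ge0_fin_numE.
apply: (@le_lt_trans _ _ ((m^-1 * m^-1) `^ p * M)%:E); last exact: ltry.
apply: energy_le => F uF FE.
apply: (@le_trans _ _ (\sum_(e <- F)
    (m^-1 * m^-1) `^ p * normc (grad k e) `^ p)).
  apply: ler_sum => e _.
  have mm : 0 <= m^-1 * m^-1 by rewrite mulr_ge0// invr_ge0 ltW.
  rewrite -powRM ?normc_ge0//.
  apply: ge0_ler_powR; rewrite ?nnegrE ?mulr_ge0 ?normc_ge0 ?(ltW p0)//.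
    by rewrite invr_ge0 ltW.
  by rewrite invr_ge0 ltW.
  have -> : grad (fun x => (k x)^-1) e =
      (k e.1)^-1 * (k e.2)^-1 * - grad k e.
    rewrite /grad opprB mulrBr mulrAC mulVf// mul1r.
    by rewrite -mulrA mulVf// mulr1.
  rewrite !normcM normcN ler_wpM2r ?normc_ge0//.
  by rewrite ler_pM ?normc_ge0.
by rewrite -mulr_sumr ler_wpM2l ?powR_ge0//; exact: sum_le_bound.
Qed.

Variable chi : {ptws BD -> R[i]^o}.
Hypotheses (chiR : Royden_boundary p1 Gamma chi) (bv : bounded_valency Gamma).

Let chiM (f g : BD) : chi (f * g) = chi f * chi g.
Proof. by have [[_ _ M _] _] := chiR; exact: M. Qed.

Let chiD (f g : BD) : chi (f + g) = chi f + chi g.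
Proof.
have [[_ L _ _] _] := chiR.
by have := L 1 f g; rewrite !scale1r.
Qed.

Let chiZ (a : R[i]) (f : BD) : chi (a *: f) = a * chi f.
Proof.
have [[_ L _ _] _] := chiR.
have chi0 : chi 0 = 0.
  by apply: (addrI (chi 0)); rewrite -chiD !addr0.
by have := L a f 0; rewrite chi0 !addr0.
Qed.

Let chiB (f g : BD) : chi (f - g) = chi f - chi g.
Proof. by rewrite chiD -scaleN1r chiZ mulN1r. Qed.

Let chi1 : chi 1 = 1.
Proof.
have [[[f f0] _ _ _] _] := chiR.
by apply: (mulIf f0); rewrite -chiM !mul1r.
Qed.

(** If [delta] is the indicator of a vertex a, then g delta = g(a) delta for all g. So chi(delta) <>
    0 would force chi to be the evaluation at a, which the Royden boundary excludes. Vertices are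
    then removed one at a time. *)
Lemma character_finite_support (l : seq Gamma) (h : BD) :
  (forall x, x \notin l -> h x = 0) -> chi h = 0.
Proof.
elim: l h => [|a l IH] h hl.
  have -> : h = 0 *: h by apply/val_inj/funext => x; rewrite scale0r; exact: hl.
  by rewrite chiZ mul0r.
pose delta_fun x : R[i] := (x == a)%:R.
have fdelta : finitely_supported delta_fun.
  apply: (@sub_finite_set _ _ [set a]) => // x /=.
  by have [//|/negbTE xa] := eqVneq x a; rewrite /delta_fun xa eqxx.
pose delta := MkBD p1 (finitely_supported_BD p1 bv fdelta).
have deltaE (g : BD) : g * delta = g a *: delta.
  apply/val_inj/funext => x.
  change (g x * delta_fun x = g a * delta_fun x); rewrite /delta_fun.
  by have [->//|_] := eqVneq x a; rewrite !mulr0.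
have delta0 : chi delta = 0.
  apply/eqP; apply: contraPT chiR => d0 [_]; apply; exists a => //.
  apply/funext => g; rewrite /evaluation; apply: (mulIf d0).
  by rewrite -chiM deltaE chiZ.
have -> : h = (h - h a *: delta) + h a *: delta by rewrite subrK.
rewrite chiD chiZ delta0 mulr0 addr0; apply: IH => x xl.
change (h x - h a * delta_fun x = 0); rewrite /delta_fun.
have [->|xa] := eqVneq x a; first by rewrite mulr1 subrr.
by rewrite mulr0 subr0; apply: hl; rewrite inE negb_or xa.
Qed.

(* If chi f = c <> 0 then f - c, corrected on the finite set where f is not
   small, is invertible in BD^p although chi annihilates it. *)
Lemma character_vanishing (f : BD) :
  (forall eps : R, 0 < eps -> finite_set [set x | eps <= normc (f x)]) ->
  chi f = 0.
Proof.
move=> fv; apply/eqP/negPn/negP => c0; set c : R[i] := chi f in c0.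
have nc0 : 0 < normc c.
  by rewrite lt_neqAle normc_ge0 eq_sym andbT; apply: contra c0 => /eqP/eq0_normc->.
have nc20 : 0 < normc c / 2 by rewrite divr_gt0.
have Afin := fv _ nc20; set A := fset_set [set x | normc c / 2 <= normc (f x)].
have AE x : (x \in A) = (normc c / 2 <= normc (f x)).
  by rewrite in_fset_set//; apply/idP/idP => [/set_mem|/mem_set].
pose e_fun x : R[i] := (x \in A)%:R.
have fe : finitely_supported e_fun.
  apply: (@sub_finite_set _ _ [set` A]); last exact: finite_fset.
  move=> x /=; have [//|/negbTE xA] := boolP (x \in A).
  by rewrite /e_fun xA eqxx.
pose e := MkBD p1 (finitely_supported_BD p1 bv fe).
have chie : chi e = 0.
  apply: (@character_finite_support A) => x /negbTE xA.
  by rewrite /= /e_fun xA.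
(* [k] is 1 on [A] and f - c elsewhere, where |f| < |c|/2 gives |f - c| >= |c|/2. *)
pose k : BD := (f - c *: (1 : BD)) * (1 - e) + e.
have chik : chi k = 0.
  by rewrite /k chiD chiM !chiB chiZ chi1 chie mulr1 subrr mul0r addr0.
pose m := Num.min 1 (normc c / 2).
have m0 : 0 < m by rewrite lt_min ltr01.
have km x : m <= normc (k x).
  have -> : k x = (f x - c * 1) * (1 - e_fun x) + e_fun x by [].
  rewrite /e_fun AE ge_min.
  have [fx|fx] := leP (normc c / 2) (normc (f x)).
    by rewrite mulr1 subrr mulr0 add0r normc1 lexx.
  rewrite subr0 addr0 !mulr1; apply/orP; right.
  rewrite normc_distrC; apply: le_trans (ler_normcB _ _).
  by lra.
pose kinv := MkBD p1 (BD_inv m0 km).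
have kK : k * kinv = 1.
  apply/val_inj/funext => x; change (k x * (k x)^-1 = 1); rewrite mulfV//.
  by apply: contraTneq (km x) => ->; rewrite normc0 -ltNge.
have := chiM k kinv; rewrite kK chik mul0r chi1 => /eqP.
by rewrite oner_eq0.
Qed.

End Characters.

(** * Equality of the boundaries from an isoperimetric profile *)

Lemma Royden_eq_harmonic (R : realType) (p d : R) (p1 : 1 < p) (Gamma : graph)
    (o : Gamma) :
  p < d -> connected_graph Gamma -> bounded_valency Gamma ->
  isoperimetric_profile d Gamma ->
  Royden_boundary p1 Gamma = harmonic_boundary p1 o.
Proof.
move=> pd conn bv iso; apply/seteqP; split => [chi chiR|chi []//].
split=> // f fD0; apply: (character_vanishing chiR bv) => eps eps0.
exact: (Dirichlet0_vanishes p1 pd bv iso conn fD0 eps0).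
Qed.

Lemma mem_fset_setW (T : choiceType) (A : set T) x : x \in fset_set A -> A x.
Proof.
have [fA|nA] := pselect (finite_set A).
  by rewrite in_fset_set// => /set_mem.
by rewrite /fset_set; case: pselect => //; rewrite in_fset0.
Qed.

(** * Isoperimetry from growth on Cayley graphs *)

Section Cayley.
Variables (G : groupType) (S : seq G).
Local Notation Gamma := (cayley_graph S).

Lemma cayley_bounded_valency : bounded_valency Gamma.
Proof.
exists (size S + size S)%N => x.
set l := [seq (x * s)%g | s <- S] ++ [seq (x * s^-1)%g | s <- S].
set F := [fset y in l]%fset.
apply: (@card_le_trans _ _ _ [set` F]).
  apply: subset_card_le => y /= /hasP[s sS]; rewrite !inE /=.
  move=> /orP[/eqP ->|/eqP ->]; first by rewrite map_f.
  by apply/orP; right; apply/mapP; exists s => //; rewrite mulgK.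
rewrite (card_le_eql (introT card_eq_fsetP (erefl #|` F|))) card_le_II card_fseq.
by rewrite (leq_trans (size_undup _))// size_cat !size_map.
Qed.

Lemma cayley_adj_mul (a x y : G) :
  cayley_adj S (a * x)%g (a * y)%g = cayley_adj S x y.
Proof. by apply: eq_has => s; rewrite -!mulgA !(inj_eq (mulgI a)). Qed.

Lemma cayley_connected : generates S -> connected_graph Gamma.
Proof.
move=> gen x y; have [w wS xy] := gen (x^-1 * y)%g.
exists (size w).
have : y = (x * \prod_(s <- w) s)%g by rewrite -xy mulVKg.
move: wS; clear xy; elim: w x => [|s w IH] x /=.
  by rewrite big_nil mulg1 => _ ->; exists [::].
move=> /andP[sS /IH{}IH]; rewrite big_cons mulgA => /IH[t [xt ty tw]].
exists ((x * s)%g :: t); split => //=; rewrite xt andbT.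
apply/hasP; case/orP: sS => sS; first by exists s; rewrite ?eqxx.
by exists (s^-1)%g => //; rewrite mulgK eqxx orbT.
Qed.

(** Induction along the path. When its endpoint moves from y to z, a point x newly sent out of A
    gives the boundary edge (xy, xz), and x is recovered from this edge; so each step adds at most
    the size of the boundary. *)
Lemma displacement_le (A : {fset Gamma}) (t : seq G) :
  path (cayley_adj S) 1%g t ->
  (count (fun x : G => (x * last 1%g t)%g \notin A) A
    <= size t * #|` fset_set (edge_boundary A)|)%N.
Proof.
elim/last_ind: t => [|t z IH].
  move=> _; rewrite mul0n leqNgt -has_count; apply/negP => /hasP[x xA].
  by rewrite /= mulg1 xA.
rewrite rcons_path last_rcons size_rcons => /andP[/IH{}IH yz].
set y := last 1%g t in IH yz.
rewrite mulSn addnC; apply: leq_trans (leq_add IH (leqnn _)).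
set P1 := fun x : G => (x * y)%g \notin A.
set P2 := fun x : G => ((x * y)%g \in A) && ((x * z)%g \notin A).
have P2b : (count P2 A <= #|` fset_set (edge_boundary A)|)%N.
  rewrite -size_filter -(size_map (fun x : G => ((x * y)%g, (x * z)%g))).
  apply: uniq_leq_size.
    by rewrite map_inj_uniq ?filter_uniq ?fset_uniq// => u v [/mulIg].
  move=> e /mapP[x]; rewrite mem_filter => /andP[/andP[xy xz] _] ->.
  rewrite in_fset_set; last exact: (finite_edge_boundary cayley_bounded_valency).
  by apply/mem_set; split => //=; rewrite /edges /= cayley_adj_mul.
apply: leq_trans (leq_add (leqnn _) P2b).
apply: (@leq_trans (count (predU P1 P2) A)); last by rewrite -count_predUI leq_addr.
by apply: sub_count => x /= xz; rewrite /P1 /P2 xz andbT orNb.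
Qed.

(** Count the pairs (x, y) in A x B with xy outside A, for a ball B of radius n with at least 2|A|
    elements. Each x keeps at most |A| of the y inside A, so at least |A||B|/2 pairs leave, while
    each y moves out at most n times the boundary size. *)
Lemma growth_isoperimetric (R : realType) (d : R) : 1 < d ->
  growth_at_least d Gamma -> isoperimetric_profile d Gamma.
Proof.
move=> d1 [c c0 gr]; have d0 : 0 < d by exact: lt_trans d1.
set K := (2 / c) `^ d^-1 + 1.
have K0 : 0 < K by rewrite ltr_wpDl ?powR_ge0.
exists (2 * K)^-1 => [|A]; first by rewrite invr_gt0 mulr_gt0.
(* Here the exponent must be non-zero, since 0 to the power 0 is 1. *)
have [->|A0] := eqVneq A fset0.
  rewrite cardfs0 powR0 ?mulr0// mulf_neq0 ?invr_eq0 ?gt_eqF//.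
  by rewrite subr_gt0.
set a := #|` A|; set b := #|` fset_set (edge_boundary A)|.
have a1 : (1 <= a)%N by rewrite cardfs_gt0.
have aR1 : 1 <= a%:R :> R by rewrite ler1n.
have aR0 : 0 < a%:R :> R by rewrite ltr0n.
(* [r] solves c r^d = 2|A|. Rounding up costs at most 1, which is at most |A|^(1/d) and is absorbed
   in [K]. *)
set r := (2 * a%:R / c) `^ d^-1.
have r0 : 0 <= r by exact: powR_ge0.
set n := (Num.trunc r).+1.
have rn : r <= n%:R by rewrite ltW// truncnS_gt.
have nr : n%:R <= K * a%:R `^ d^-1.
  apply: (@le_trans _ _ (r + 1)).
    by rewrite /n -natr1 lerD2r; have /andP[] := truncn_itv r0.
  rewrite /r /K [leRHS]mulrDl mul1r mulrAC powRM ?divr_ge0 ?(ltW c0)// lerD2l.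
  apply: (@le_trans _ _ (1 `^ d^-1)); first by rewrite powR1.
  by apply: ge0_ler_powR; rewrite ?nnegrE ?ler0n ?invr_ge0 ?(ltW d0).
set B := fset_set (gball (1%g : Gamma) n).
have Ba : 2 * a%:R <= #|` B|%:R :> R.
  apply: le_trans (gr (1%g : Gamma) n isT).
  have -> : 2 * a%:R = c * r `^ d.
    by rewrite /r -powRrM mulVf ?gt_eqF// powRr1 ?divr_ge0 ?mulr_ge0 ?(ltW c0)//
      mulrCA divff ?gt_eqF// mulr1.
  by rewrite ler_pM2l//; apply: ge0_ler_powR; rewrite ?nnegrE// ltW.
have upper : (\sum_(y <- B) count (fun x : G => (x * y)%g \notin A) A
    <= #|` B| * (n * b))%N.
  rewrite [X in (_ <= X * _)%N]card_fset_sum1 big_distrl/= big_seq [leqRHS]big_seq.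
  apply: leq_sum => y /mem_fset_setW[t [pt <- tn]].
  by rewrite mul1n (leq_trans (displacement_le _ pt))// leq_mul2r tn orbT.
have lower : (a * (#|` B| - a) <=
    \sum_(y <- B) count (fun x : G => (x * y)%g \notin A) A)%N.
  under eq_bigr do rewrite -sum1_count big_mkcond.
  rewrite exchange_big/= [X in (X * _ <= _)%N]card_fset_sum1 big_distrl/=.
  apply: leq_sum => x _.
  rewrite mul1n -big_mkcond sum1_count leq_subLR.
  rewrite -(count_predC (fun y : G => (x * y)%g \in A) B) leq_add2r.
  rewrite -size_filter -(size_map (fun y => x * y)%g); apply: uniq_leq_size.
    by rewrite map_inj_uniq ?filter_uniq ?fset_uniq//; exact: mulgI.
  by move=> z /mapP[y]; rewrite mem_filter => /andP[yA _] ->.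
have := leq_trans lower upper; rewrite -(ler_nat R) !natrM.
have aB : (a <= #|` B|)%N.
  by rewrite -(ler_nat R) (le_trans _ Ba)// ler_peMl ?ler0n ?ler1n.
rewrite natrB// => main.
have B0 : 0 < #|` B|%:R :> R by rewrite (lt_le_trans _ Ba)// mulr_gt0.
have half : a%:R / 2 <= n%:R * b%:R :> R.
  rewrite -(ler_pM2l B0); apply: le_trans main.
  rewrite mulrCA ler_wpM2l ?ler0n//.
  by lra.
have : a%:R / 2 <= K * a%:R `^ d^-1 * b%:R.
  by apply: le_trans half _; rewrite (ler_wpM2r _ nr).
have ad0 : 0 < a%:R `^ d^-1 :> R by rewrite powR_gt0.
(* This splitting lets the factor |A|^(1/d) coming from the radius cancel. *)
have aE : a%:R = a%:R `^ ((d - 1) / d) * a%:R `^ d^-1 :> R.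
  rewrite -powRD; last by apply/implyP => _; rewrite gt_eqF.
  by rewrite mulrBl mul1r divff ?gt_eqF// subrK powRr1// ltW.
rewrite [X in X / 2 <= _]aE mulrAC [leRHS]mulrAC ler_pM2r// => H.
by rewrite invfM mulrC mulrA ler_pdivrMr// [leRHS]mulrC.
Qed.

End Cayley.

Theorem corollary5p10 (R : realType) (p d : R) (p1 : 1 < p)
    (Gamma : graph) (o : Gamma)
    (H : (p < d /\
          exists (G : groupType) (S : seq G),
            [/\ generates S,
                growth_at_least d (cayley_graph S) &
                Gamma = cayley_graph S])
         \/
         (p < d / 2 /\
          [/\ infinite_graph Gamma,
              connected_graph Gamma,
              bounded_valency Gamma &
              isoperimetric_profile d Gamma])) :
  Royden_boundary p1 Gamma = harmonic_boundary p1 o.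
Proof.
case: H => [[pd [G [S [gen gr GammaE]]]]|[pd2 [_ conn bv iso]]].
  subst Gamma; apply: (Royden_eq_harmonic p1 o pd (cayley_connected gen)).
    exact: cayley_bounded_valency.
  exact: growth_isoperimetric (lt_trans p1 pd) gr.
(* Positivity of p makes d positive, so d/2 < d. *)
have pd : p < d by move: (lt_trans ltr01 p1) => p0; lra.
exact: (Royden_eq_harmonic p1 o pd conn bv iso).
Qed.
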